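(* Let $n$ and $\Delta$ be positive integers such that $\Delta\ge \frac{3(n-1)}{4}$. If $G$ is obtained from an $(n-1)$-vertex $\Delta$-regular class 1 graph by a vertex-splitting, then $G$ is $\Delta$-critical.
   Context: All graphs are simple and finite. For a graph $G$, $\Delta(G)$ denotes its maximum degree and $\chi'(G)$ its chromatic index; by Vizing's theorem $\chi'(G)\in\{\Delta(G),\Delta(G)+1\}$, and $G$ is class 1 if $\chi'(G)=\Delta(G)$ and class 2 otherwise. A graph $G$ is $\Delta$-critical (edge-chromatic critical) if $\chi'(G)=\Delta(G)+1$ and $\chi'(H)<\Delta(G)+1$ for every proper subgraph $H$ of $G$. A vertex-splitting of a graph $G$ at a vertex $v$ replaces $v$ by two new adjacent vertices $v_1,v_2$ and partitions $N_G(v)$ into two nonempty subsets which serve as the neighborhoods (apart from each other) of $v_1$ and $v_2$, respectively; the resulting graph is said to be obtained from $G$ by a vertex-splitting. *)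

(* Defs.v *)
From mathcomp Require Import all_boot.

Set Implicit Arguments.
Unset Strict Implicit.
Unset Printing Implicit Defensive.

(* Finite simple graphs whose vertices are drawn from an ambient finite type T,
   so that a graph, its subgraphs and its vertex-splittings all live over the
   same T. *)
Record sgraph (T : finType) := SGraph {
  vertices : {set T};
  edges : {set {set T}};
  edgesP : [forall e in edges, (e \subset vertices) && (#|e| == 2)]
}.

Section Graphs.

Variable T : finType.
Implicit Types (G H : sgraph T) (u v : T) (k d : nat).

Definition neighborhood G v : {set T} := [set u | [set v; u] \in edges G].

Definition degree G v : nat := #|neighborhood G v|.

Definition max_degree G : nat := \max_(v in vertices G) degree G v.

Definition regular d G : Prop := forall v, v \in vertices G -> degree G v = d.

(* Colourings are defined on the edges only, not on all of {set T}: otherwise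
   an edgeless graph would not be colourable with 0 colours. *)
Definition edge_type G : finType := {e : {set T} | e \in edges G}.

Definition proper_edge_coloring G k (c : {ffun edge_type G -> 'I_k}) : bool :=
  [forall e : edge_type G, forall f : edge_type G,
     (e != f) && ~~ [disjoint val e & val f] ==> (c e != c f)].

Definition edge_colorable G k : bool :=
  [exists c : {ffun edge_type G -> 'I_k}, proper_edge_coloring c].

Lemma edge_colorable_ex G : exists k, edge_colorable G k.
Proof.
exists #|edge_type G|; apply/existsP; exists [ffun e => enum_rank e].
apply/forallP => e; apply/forallP => f; apply/implyP => /andP[ne_ef _].
by rewrite !ffunE (inj_eq enum_rank_inj).
Qed.

Definition chromatic_index G : nat := ex_minn (edge_colorable_ex G).

Definition class1 G : Prop := chromatic_index G = max_degree G.

Definition subgraph H G : bool :=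
  (vertices H \subset vertices G) && (edges H \subset edges G).

Definition proper_subgraph H G : bool := subgraph H G && ~~ subgraph G H.

Definition critical d G : Prop :=
  [/\ max_degree G = d,
      chromatic_index G = (max_degree G).+1
    & forall H, proper_subgraph H G -> chromatic_index H < (max_degree G).+1].

(* G is obtained from G0 by replacing v with the new vertices v1 and v2, whose
   neighborhoods apart from each other are N1 and N2. *)
Definition is_splitting_at G0 G (v v1 v2 : T) (N1 N2 : {set T}) : Prop :=
  [/\ [/\ v \in vertices G0, v1 \notin vertices G0, v2 \notin vertices G0
        & v1 != v2],
      [/\ N1 != set0, N2 != set0, [disjoint N1 & N2]
        & N1 :|: N2 = neighborhood G0 v],
      vertices G = v1 |: (v2 |: (vertices G0 :\ v))
    & edges G = [set v1; v2] |: ([set e in edges G0 | v \notin e]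
                  :|: [set [set v1; u] | u in N1]
                  :|: [set [set v2; u] | u in N2])].

Definition vertex_splitting G0 G : Prop :=
  exists v v1 v2 : T, exists N1 N2 : {set T},
    is_splitting_at G0 G v v1 v2 N1 N2.

End Graphs.

(* Main.v *)
Require Import Defs.
From mathcomp Require Import all_boot fingroup perm zify.

Set Implicit Arguments.
Unset Strict Implicit.
Unset Printing Implicit Defensive.

(* Let G be the splitting at v of the D-regular class 1 graph G0. A colour class misses a vertex
   of G, which has odd order, and only v1 and v2 miss colours, D - 2 altogether: so G is not
   D-colourable. To colour G - xy, suppose this impossible and start from the colouring of
   G - xy - v1v2 induced by one of G0; every colour is missing at exactly one of v1, v2, and x, y
   miss a common colour. Any colour missing at one end of the uncoloured edge and any colour
   missing at the other are joined by a Kempe chain, which then contains no third end. This yields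
   - a Vizing fan argument if x or y is adjacent to v;
   - a Kierstead path v1 v2 w x, for w a common neighbour of v and x, if v2 misses two colours;
   - a "kite" if N1 = {u}: for a common neighbour w of u, v, x, y, which exists as D >= 3(n-1)/4,
     one first arranges that wx has the colour p missing at v2 and that x and y miss a colour q.
     Moving the uncoloured edge to v2w or to uw then shows that, after removal of wy, the chain
     of w for p and the colour of wy ends at v2 and, with v1u traded for v1v2, at u, which is
     absurd. *)

(** * Edge colourings as families of involutions *)

Section Matchings.

Variables T K : finType.
Implicit Types (s : K -> T -> T) (R : rel T) (a b c x y z : T) (k l p q : K).
Implicit Type C : {set T}.

Definition same_edge a b : rel T :=
  fun x y => ((x == a) && (y == b)) || ((x == b) && (y == a)).

Definition del R a b : rel T := fun x y => R x y && ~~ same_edge a b x y.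

(* The colour class of [k] is encoded as the involution [s k] exchanging the two ends of each
   of its edges; a fixed point of [s k] is a vertex at which [k] is missing. *)
Definition colours s R :=
  [/\ forall k, involutive (s k),
      forall k l z, s k z = s l z -> s k z != z -> k = l,
      forall k z, s k z != z -> R z (s k z)
    & forall x y, R x y -> y != x /\ exists k, s k x = y].

Lemma same_edgeC a b x y : same_edge a b x y = same_edge b a x y.
Proof. exact: orbC. Qed.

Lemma del_sym R a b : symmetric R -> symmetric (del R a b).
Proof.
move=> Rsym x y; rewrite /del Rsym; congr (_ && ~~ _).
by rewrite /same_edge orbC andbC [X in _ || X]andbC.
Qed.

Lemma colours_ext s R R' : R =2 R' -> colours s R -> colours s R'.
Proof.
move=> eR [sK sI sR Rs]; split=> // [k z /sR|x y]; first by rewrite eR.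
by rewrite -eR => /Rs.
Qed.

Lemma coloursC s R a b : colours s (del R a b) -> colours s (del R b a).
Proof. by apply: colours_ext => x y; rewrite /del same_edgeC. Qed.

Lemma near_edge s R a b x y :
  colours s (del R a b) -> R x y -> ~~ same_edge a b x y -> exists k, s k x = y.
Proof. by move=> [_ _ _ Rs] Rxy ne; case: (Rs x y); rewrite // /del Rxy. Qed.

(** Composing the matching with a transposition removes the edge [ab] if it is there and adds it if
    both ends are fixed, so one formula serves both operations. *)
Definition toggle s k a b l z := if l == k then tperm a b (s l z) else s l z.

Lemma toggle_other s k a b l z : l != k -> toggle s k a b l z = s l z.
Proof. by rewrite /toggle => /negbTE->. Qed.

Lemma toggle_off s k a b z :
  involutive (s k) -> s k a = b ->
  toggle s k a b k z = if (z == a) || (z == b) then z else s k z.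
Proof.
move=> sK skab; have skba : s k b = a by rewrite -skab sK.
rewrite /toggle eqxx; case: eqP => [->|/eqP nza] /=; first by rewrite skab tpermR.
case: eqP => [->|/eqP nzb] /=; first by rewrite skba tpermL.
by rewrite tpermD // eq_sym (inv_eq sK) ?skab ?skba // eq_sym.
Qed.

Lemma toggle_on s k a b z :
  involutive (s k) -> s k a = a -> s k b = b ->
  toggle s k a b k z = if z == a then b else if z == b then a else s k z.
Proof.
move=> sK ska skb.
rewrite /toggle eqxx; case: eqP => [->|/eqP nza] /=; first by rewrite ska tpermL.
case: eqP => [->|/eqP nzb] /=; first by rewrite skb tpermR.
by rewrite tpermD // eq_sym (inv_eq sK) ?ska ?skb.
Qed.

Lemma del_colours s R k a b :
  b != a -> s k a = b -> colours s R -> colours (toggle s k a b) (del R a b).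
Proof.
move=> nba skab [sK sI sR Rs]; have skba : s k b = a by rewrite -skab sK.
have tE z := toggle_off z (sK k) skab.
have sub l z : toggle s k a b l z != z -> toggle s k a b l z = s l z.
  case: (eqVneq l k) => [->|nlk]; last by rewrite toggle_other.
  by rewrite tE; case: ifP => //; rewrite eqxx.
split.
- move=> l z; case: (eqVneq l k) => [->|nlk]; last by rewrite !toggle_other // sK.
  rewrite (tE z); case: ifP => zab; first by rewrite tE zab.
  by rewrite tE !(inv_eq (sK k)) skab skba orbC zab sK.
- by move=> l1 l2 z e nz; have nz2 := nz; rewrite e in nz2; apply: (sI _ _ z); rewrite -!sub.
- move=> l z nz; have e := sub l z nz; rewrite e /del sR -?e //= e.
  apply/negP => /orP[]/andP[/eqP ez /eqP es].
    have := sI l k z; rewrite es ez skab => /(_ erefl nba) elk.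
    by move: nz; rewrite elk tE ez eqxx eqxx.
  have := sI l k z; rewrite es ez skba eq_sym => /(_ erefl nba) elk.
  by move: nz; rewrite elk tE ez eqxx orbT eqxx.
- move=> x y /andP[/Rs[nyx [l slx]] ne]; split=> //; exists l.
  case: (eqVneq l k) => [elk|nlk]; last by rewrite toggle_other.
  move: slx ne; rewrite elk tE; case: ifP => // /orP[]/eqP-> <-.
    by rewrite /same_edge skab !eqxx.
  by rewrite /same_edge skba !eqxx orbT.
Qed.

Lemma add_colours s R k a b : a != b -> R a b -> R b a ->
  colours s (del R a b) -> s k a = a -> s k b = b -> colours (toggle s k a b) R.
Proof.
move=> nab Rab Rba [sK sI sR Rs] ska skb; have tE z := toggle_on z (sK k) ska skb.
(* No colour class contains [ab], so the new edge of colour [k] clashes with none of them. *)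
have sE l x : same_edge a b x (s l x) = false.
  apply/negP => e; case: (eqVneq (s l x) x) => [esx|/sR]; last first.
    by rewrite /del e andbF.
  by move: e; rewrite esx => /orP[]/andP[/eqP-> /eqP eab]; rewrite eab eqxx in nab.
have inj l z : l != k -> toggle s k a b k z = s l z -> s l z != z -> False.
  move=> nlk; rewrite tE; case: (eqVneq z a) => [->|_].
    by move=> e; have := sE l a; rewrite -e /same_edge !eqxx.
  case: (eqVneq z b) => [->|_].
    by move=> e; have := sE l b; rewrite -e /same_edge !eqxx orbT.
  by move=> e nz; move: nlk; rewrite (sI l k z) ?eqxx.
split.
- move=> l z; case: (eqVneq l k) => [->|nlk]; last by rewrite !toggle_other // sK.
  rewrite (tE z); case: (eqVneq z a) => [->|nza].
    by rewrite tE eqxx; case: eqP => // ->.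
  case: (eqVneq z b) => [->|nzb]; first by rewrite tE eqxx.
  by rewrite tE !(inv_eq (sK k)) ska skb (negbTE nza) (negbTE nzb) sK.
- move=> l1 l2 z; case: (eqVneq l1 k) => [->|n1]; case: (eqVneq l2 k) => [->|n2] //.
  + by rewrite (toggle_other _ _ _ _ n2) => e; rewrite e => /(inj _ _ n2 e).
  + by rewrite (toggle_other _ _ _ _ n1) => e /(inj _ _ n1 (esym e)).
  + by rewrite !toggle_other //; apply: sI.
- move=> l z; case: (eqVneq l k) => [->|nlk]; last first.
    by rewrite toggle_other // => /sR/andP[].
  rewrite tE; case: (eqVneq z a) => [->|_] //; case: (eqVneq z b) => [->|_] //.
  by move=> /sR/andP[].
- move=> x y Rxy; case: (boolP (same_edge a b x y)) => [e|ne].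
    split; first by case/orP: e => /andP[/eqP-> /eqP->] //; rewrite eq_sym.
    exists k; rewrite tE; case/orP: e => /andP[/eqP-> /eqP->]; rewrite eqxx //.
    by case: eqP => // ->.
  have [nyx [l slx]] : y != x /\ exists l, s l x = y by apply: Rs; rewrite /del Rxy.
  split=> //; exists l; case: (eqVneq l k) => [elk|nlk]; last by rewrite toggle_other.
  move: slx nyx; rewrite elk tE.
  case: (eqVneq x a) => [->|_]; first by rewrite ska => ->; rewrite eqxx.
  by case: (eqVneq x b) => [->|_ //]; rewrite skb => ->; rewrite eqxx.
Qed.

(** * Moving the uncoloured edge *)

Definition shift s k a b c := toggle (toggle s k a c) k a b.

Lemma shift_other s k a b c l z : l != k -> shift s k a b c l z = s l z.
Proof. by move=> nlk; rewrite /shift !toggle_other. Qed.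

Lemma shiftE s k a b c z :
  involutive (s k) -> s k b = b -> s k a = c ->
  shift s k a b c k z = if z == a then b else if z == b then a
                        else if z == c then c else s k z.
Proof.
move=> sK skb skac; have skca : s k c = a by rewrite -skac sK.
rewrite /shift /toggle !eqxx.
case: (eqVneq z a) => [->|nza]; first by rewrite skac tpermR tpermL.
case: (eqVneq z b) => [ezb|nzb].
  have nba : b != a by rewrite -ezb.
  have ncb : c != b by rewrite -skac (inv_eq sK) skb eq_sym.
  by rewrite ezb skb [tperm a c b]tpermD ?tpermR // eq_sym.
case: (eqVneq z c) => [ezc|nzc]; first rewrite ezc skca tpermL.
  by rewrite tpermD // eq_sym // -?ezc.
rewrite [tperm a c _]tpermD ?tpermD // eq_sym (inv_eq sK) ?skb ?skac ?skca //.
Qed.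

(* Colouring [ab] with the colour [k] of [ac] moves the uncoloured edge from [ab] to [ac]. *)
Lemma shift_colours s R k a b c :
  a != b -> R a b -> R b a -> colours s (del R a b) ->
  s k b = b -> s k a = c -> c != a -> colours (shift s k a b c) (del R a c).
Proof.
move=> nab Rab Rba cs skb skac nca; have [sK _ _ _] := cs.
have ncb : c != b by rewrite -skac (inv_eq (sK k)) skb.
have tE z := toggle_off z (sK k) skac.
have ne : ~~ same_edge a c a b /\ ~~ same_edge a c b a.
  by rewrite /same_edge (eq_sym b a) (eq_sym b c) (negbTE nab) (negbTE ncb) !andbF.
apply: add_colours => //; rewrite ?tE ?eqxx //.
- by rewrite /del Rab; case: ne.
- by rewrite /del Rba; case: ne.
- have := del_colours nca skac cs; apply: colours_ext => x y.
  by rewrite /del -!andbA [X in _ && X]andbC.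
- by rewrite skb if_same.
Qed.

(** * Kempe changes and Kempe chains *)

Definition swap s k l C j z := s (if z \in C then tperm k l j else j) z.

(** Such a [C] is a union of Kempe chains, so [swap] treats both ends of an edge of colour [k] or
    [l] alike. *)
Definition closed2 s k l C :=
  (forall z, (s k z \in C) = (z \in C)) /\ (forall z, (s l z \in C) = (z \in C)).

Lemma swap_other s k l C j z : j != k -> j != l -> swap s k l C j z = s j z.
Proof. by move=> jk jl; rewrite /swap tpermD ?if_same // eq_sym. Qed.

Lemma swap_out s k l C j z : z \notin C -> swap s k l C j z = s j z.
Proof. by rewrite /swap => /negbTE->. Qed.

Lemma swap_inl s k l C z : z \in C -> swap s k l C k z = s l z.
Proof. by rewrite /swap => ->; rewrite tpermL. Qed.

Lemma swap_inr s k l C z : z \in C -> swap s k l C l z = s k z.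
Proof. by rewrite /swap => ->; rewrite tpermR. Qed.

Lemma swap_colours s R k l C :
  closed2 s k l C -> colours s R -> colours (swap s k l C) R.
Proof.
move=> [ck cl] [sK sI sR Rs]; split.
- move=> j z; rewrite /swap; case: (eqVneq j k) => [->|jk].
    by rewrite tpermL; case: (boolP (z \in C)) => zC; rewrite ?ck ?cl ?zC ?(negbTE zC) sK.
  case: (eqVneq j l) => [->|jl].
    by rewrite tpermR; case: (boolP (z \in C)) => zC; rewrite ?ck ?cl ?zC ?(negbTE zC) sK.
  by rewrite tpermD 1?eq_sym // !if_same sK.
- move=> i j z; rewrite /swap; case: ifP => _ e nz; last exact: sI e nz.
  exact: perm_inj (sI _ _ _ e nz).
- by move=> j z; apply: sR.
- move=> x y /Rs[nyx [j sj]]; split=> //.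
  by exists (if x \in C then tperm k l j else j); rewrite /swap; case: (x \in C); rewrite ?tpermK.
Qed.

(** The vertex set of the Kempe chain through [x]; a fixed point only contributes a loop. *)
Definition comp s k l x : {set T} :=
  [set y | connect (fun x y => (y == s k x) || (y == s l x)) x y].

Lemma comp_refl s k l x : x \in comp s k l x.
Proof. by rewrite inE connect0. Qed.

Lemma comp_stepl s k l x z : z \in comp s k l x -> s k z \in comp s k l x.
Proof. by rewrite !inE => /connect_trans; apply; rewrite connect1 ?eqxx. Qed.

Lemma comp_stepr s k l x z : z \in comp s k l x -> s l z \in comp s k l x.
Proof. by rewrite !inE => /connect_trans; apply; rewrite connect1 ?eqxx ?orbT. Qed.

Lemma comp_closed s k l x :
  involutive (s k) -> involutive (s l) -> closed2 s k l (comp s k l x).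
Proof.
move=> sk sl; split=> z; apply/idP/idP; try exact: comp_stepl; try exact: comp_stepr.
  by move/comp_stepl; rewrite sk.
by move/comp_stepr; rewrite sl.
Qed.

Lemma closedC s k l C : closed2 s k l C -> closed2 s k l (~: C).
Proof. by move=> [ck cl]; split=> z; rewrite !inE ?ck ?cl. Qed.

Lemma comp_sub s k l x C :
  x \in C -> (forall z, z \in C -> s k z \in C) ->
  (forall z, z \in C -> s l z \in C) -> comp s k l x \subset C.
Proof.
move=> xC ck cl; apply/subsetP => y; rewrite inE => /connectP[r + ->].
elim: r x xC => //= z r IH x xC /andP[/orP[]/eqP-> /IH]; apply; [exact: ck | exact: cl].
Qed.

Lemma comp_swapc s k l x : comp s k l x = comp s l k x.
Proof.
apply/eqP; rewrite eqEsubset; apply/andP; split.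
  by apply: comp_sub; rewrite ?comp_refl // => z; [apply: comp_stepr|apply: comp_stepl].
by apply: comp_sub; rewrite ?comp_refl // => z; [apply: comp_stepr|apply: comp_stepl].
Qed.

Lemma eq_comp s s' k l x : s k =1 s' k -> s l =1 s' l -> comp s k l x = comp s' k l x.
Proof.
by move=> ek el; apply/setP => y; rewrite !inE; apply: eq_connect => z t; rewrite ek el.
Qed.

(** Steps are reversible, so the vertices whose chain contains [x] form a set closed under both
    matchings. *)
Lemma comp_sym s k l x y : involutive (s k) -> involutive (s l) ->
  y \in comp s k l x -> x \in comp s k l y.
Proof.
move=> sk sl xy; have [ck cl] := comp_closed y sk sl.
have : comp s k l x \subset [set z | (x \in comp s k l z)].
  apply: comp_sub; first by rewrite inE comp_refl.
  - move=> z; rewrite !inE => /(connect_trans _); apply.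
    by apply: connect1; rewrite sk eqxx.
  - move=> z; rewrite !inE => /(connect_trans _); apply.
    by apply: connect1; rewrite sl eqxx orbT.
by move/subsetP/(_ y xy); rewrite inE.
Qed.

(** Such a vertex is an end of its chain, or the whole chain if both colours are missing. *)
Definition missing2 s k l z := s k z = z \/ s l z = z.

(* From an end fixed by [s k], the component is the orbit of [f := s k \o s l], on which
   [s k] acts as [i |-> - i] and [s l] as [i |-> - (i + 1)]; so another end has
   index half the length of the orbit. *)
Lemma missing2_index s k l x y : involutive (s k) -> involutive (s l) ->
  s k x = x -> missing2 s k l y -> y \in comp s k l x -> y != x ->
  y = iter (fingraph.order (s k \o s l) x)./2 (s k \o s l) x.
Proof.
move=> sk sl skx ey cy nyx; set f := s k \o s l; pose g := s l \o s k.
set L := fingraph.order f x.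
have fI : injective f by apply: inj_comp; apply: inv_inj.
have gK i z : iter i f (iter i g z) = z.
  have fg w : f (g w) = w by rewrite /f /g /= sl sk.
  by elim: i => // i IH; rewrite iterSr iterS fg.
have skf i : s k (iter i f x) = iter i g x.
  by elim: i => // i IH; rewrite !iterS -IH /f /g /= !sk.
have slf i : s l (iter i f x) = iter i.+1 g x by rewrite iterS -skf /g /= sk.
have gC i : fconnect f x (iter i g x).
  by rewrite fconnect_sym // -{2}(gK i x) fconnect_iter.
have fC z : z \in comp s k l x -> fconnect f x z.
  have /subsetP sub : comp s k l x \subset [set z | fconnect f x z].
    apply: comp_sub => [|w|w]; rewrite !inE ?connect0 // => /iter_findex<-.
      by rewrite skf.
    by rewrite slf.
  by move/sub; rewrite inE.
(* Within two turns of the orbit [x] recurs only at [0] and [L]; the indices [2i] and [2i + 1] used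
   below are in this range. *)
have per n : n < L + L -> iter n f x = x -> n = 0 \/ n = L.
  move=> lt fn; case: (ltnP n L) => [nL|Ln].
    left; have := findex_iter nL; rewrite fn; by rewrite findex0.
  right; have : n - L < L by rewrite ltn_subLR.
  move/findex_iter; have -> : iter (n - L) f x = x.
    by rewrite -{1}(iter_order fI x) -/L -iterD subnK.
  rewrite findex0.
  by move=> e; apply/eqP; rewrite eqn_leq Ln -subn_eq0 -e eqxx.
have := fC y cy; set i := findex f x y => fxy.
have iL : i < L by apply: findex_max.
have yE : y = iter i f x by rewrite iter_findex.
rewrite yE; congr (iter _ f x).
case: ey; rewrite yE.
  (* If [s k] fixes [y], then [2i] iterations of [f] fix [x], and [2i = 0] would give [y = x]. *)
  rewrite skf => e; have : iter (i + i) f x = x by rewrite iterD -e gK.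
  case/per => [||e2]; last by rewrite -/L -e2 addnn doubleK.
    by rewrite -addnS leq_add // ltnW.
  by move/eqP; rewrite addn_eq0 => /andP[/eqP i0 _]; rewrite yE i0 eqxx in nyx.
(* If [s l] fixes [y], then [2i + 1 = L], whose half is rounded down to [i]. *)
rewrite slf => e; have : iter (i.+1 + i) f x = x by rewrite iterD -e gK.
case/per => [||e2] //; last by rewrite -/L -e2 addSn addnn -uphalfE uphalf_half odd_double doubleK.
by rewrite -addnS leq_add.
Qed.

(** Both other ends have the same index in the orbit of [x]; if [s l] is the one that fixes [x], the
    two colours exchange roles. *)
Lemma two_ends s k l x y z : involutive (s k) -> involutive (s l) ->
  missing2 s k l x -> missing2 s k l y -> missing2 s k l z ->
  y \in comp s k l x -> z \in comp s k l x -> y != x -> z != x -> y = z.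
Proof.
move=> sk sl [skx|slx] ey ez cy cz nyx nzx.
  by rewrite (missing2_index sk sl skx ey) // [RHS](missing2_index sk sl skx ez).
rewrite (comp_swapc s k) in cy cz.
have ey' : missing2 s l k y by case: ey; [right|left].
have ez' : missing2 s l k z by case: ez; [right|left].
by rewrite (missing2_index sl sk slx ey') // [RHS](missing2_index sl sk slx ez').
Qed.

(** * Fans, Kierstead paths and kites at an uncoloured edge *)

Section NotColourable.

Variable H : rel T.
Hypotheses (Hsym : symmetric H) (Hirr : irreflexive H).
Hypothesis noH : forall s, ~ colours s H.

Definition near a b s := H a b /\ colours s (del H a b).

Lemma nearC a b s : near a b s -> near b a s.
Proof. by case=> Hab /coloursC cs; split=> //; rewrite Hsym. Qed.

Lemma near_inv a b s : near a b s -> forall k, involutive (s k).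
Proof. by case=> _ []. Qed.

Lemma near_swap a b s k l C : near a b s -> closed2 s k l C -> near a b (swap s k l C).
Proof. by case=> Hab cs cC; split=> //; apply: swap_colours. Qed.

Lemma near_swap_comp a b s k l z : near a b s -> near a b (swap s k l (comp s k l z)).
Proof. by move=> ns; apply: near_swap (ns) _; apply: comp_closed; apply: near_inv ns _. Qed.

Lemma H_neq a b : H a b -> a != b.
Proof. by apply: contraTneq => ->; rewrite Hirr. Qed.

Lemma near_shift a b c s k : near a b s -> s k b = b -> s k a = c -> c != a ->
  near a c (shift s k a b c).
Proof.
move=> [Hab cs] skb skac nca; split.
  case: cs => _ _ sR _; have := sR k a; rewrite skac => /(_ nca)/andP[] //.
by apply: shift_colours => //; [exact: H_neq | rewrite Hsym].
Qed.

Lemma no_common_missing a b s k : near a b s -> s k a = a -> s k b = b -> False.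
Proof.
move=> [Hab cs] ska skb; apply: (@noH (toggle s k a b)).
by apply: add_colours => //; [exact: H_neq | rewrite Hsym].
Qed.

(** Otherwise a Kempe change on the chain of [a] makes [l] missing at both ends of [ab], which could
    then be coloured. *)
Lemma link a b s k l : near a b s -> s k a = a -> s l b = b -> b \in comp s k l a.
Proof.
move=> ns ska slb; apply/negPn/negP => nb.
apply: (no_common_missing (near_swap_comp k l a ns) (k := l)).
  by rewrite swap_inr ?comp_refl.
by rewrite swap_out.
Qed.

(** One chain already has [a] and [b] as its ends, so no third end lies on it. *)
Lemma apart a b s k l z : near a b s -> s k a = a -> s l b = b ->
  z != a -> z != b -> missing2 s k l z ->
  a \notin comp s k l z /\ b \notin comp s k l z.
Proof.
move=> ns ska slb nza nzb mz; have sK := near_inv ns.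
have ab := link ns ska slb; have [Hab _] := ns.
have ma : missing2 s k l a by left.
have mb : missing2 s k l b by right.
split; apply/negP => /(comp_sym (sK k) (sK l)) zC.
  by have := two_ends (sK k) (sK l) ma mb mz ab zC; rewrite eq_sym H_neq // => /(_ isT nza) e;
     rewrite e eqxx in nzb.
have ba := comp_sym (sK k) (sK l) ab.
by have := two_ends (sK k) (sK l) mb ma mz ba zC; rewrite H_neq // => /(_ isT nzb) e;
   rewrite e eqxx in nza.
Qed.

(** Moving the uncoloured edge from [ab] to [ac] alters only the colour [p], which differs from [k]
    and [l], so [link] applies at [ac] to an unchanged chain. *)
Lemma fan_link a b c s p k l : near a b s -> s p b = b -> s p a = c -> c != a ->
  s k a = a -> s l c = c -> c \in comp s k l a.
Proof.
move=> ns spb spa nca ska slc; have sK := near_inv ns.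
have kp : k != p by apply: contraNneq nca => e; rewrite -spa -e ska.
have spc : s p c = a by rewrite -spa sK.
have lp : l != p by apply: contraNneq nca => e; rewrite -spc -e slc.
have := link (k := k) (l := l) (near_shift ns spb spa nca).
rewrite !shift_other // => /(_ ska slc).
by rewrite (@eq_comp _ s) // => z; rewrite shift_other.
Qed.

(** A fan with the single leaf [z]: a colour missing at both [a] and [z] completes the colouring
    once the uncoloured edge has moved to [az]. If [q] is missing at [b] instead, it is first
    exchanged with [p] on the chain of [z], which avoids [a] and [b]. *)
Lemma fan_full a b z s p q : near a b s -> (forall k, s k a = a \/ s k b = b) ->
  s p a = a -> H a z -> z != b -> s q z <> z.
Proof.
move=> ns cov spa Haz nzb sqz; have nza : z != a by rewrite eq_sym H_neq.
have [r sra] : exists r, s r a = z.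
  case: ns => Hab cs; apply: near_edge cs Haz _.
  by rewrite /same_edge (negbTE nzb) (negbTE nza) !andbF.
have srb : s r b = b by case: (cov r) => // e; rewrite -sra e eqxx in nza.
have main s' t : near a b s' -> s' r a = z -> s' r b = b -> s' t a = a -> s' t z = z -> False.
  move=> ns' s'ra s'rb s'ta s'tz.
  have tr : t != r by apply: contraNneq nza => e; rewrite -s'ra -e s'ta.
  by apply: (no_common_missing (near_shift ns' s'rb s'ra nza) (k := t)); rewrite shift_other.
case: (cov q) => [sqa|sqb]; first exact: main ns sra srb sqa sqz.
have [aC bC] : a \notin comp s p q z /\ b \notin comp s p q z.
  by apply: apart ns spa sqb nza nzb _; right.
apply: (main _ p (near_swap_comp p q z ns)); try by rewrite swap_out.
by rewrite swap_inl ?comp_refl.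
Qed.

(** After exchanging [i] and [p] on the chain of [x], the chain of [b] for [i] and [j] is the path
    [b w x], whereas it ought to end at [a]. *)
Lemma kierstead_core a b w x s i j p : near a b s -> w != a -> w != b -> x != a -> x != b ->
  s p b = b -> s p x = x -> s i a = a -> s i b = w -> s j b = b -> s j w = x -> False.
Proof.
move=> ns nwa nwb nxa nxb spb spx sia sib sjb sjw; have sK := near_inv ns.
have [aC bC] : a \notin comp s i p x /\ b \notin comp s i p x.
  by apply: apart ns sia spb nxa nxb _; right.
have wC : w \notin comp s i p x.
  by apply: contra bC => /comp_stepl; rewrite -sib sK.
set s' := swap s i p (comp s i p x).
have ns' : near a b s' by apply: near_swap_comp.
have s'i : s' i x = x by rewrite /s' swap_inl ?comp_refl.
have s'K := near_inv ns'.
have s'ia : s' i a = a by rewrite /s' swap_out.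
have s'jb : s' j b = b by rewrite /s' swap_out.
have aD : a \in comp s' j i b by apply: link (nearC ns') _ _.
have xD : x \in comp s' j i b.
  have <- : s' j (s' i b) = x by rewrite /s' (swap_out _ _ _ _ bC) sib swap_out.
  by apply/comp_stepl/comp_stepr/comp_refl.
have [Hab _] := ns.
have := two_ends (s'K j) (s'K i) (or_introl s'jb) (or_intror s'ia) (or_intror s'i) aD xD.
by rewrite H_neq // => /(_ isT nxb) e; rewrite e eqxx in nxa.
Qed.

(** If the colour [j] of [wx] is missing at [a], exchanging it with [p] on the chain of [x] gives
    [wx] the colour [p], missing at [b]. Now [x] misses [j], which a second Kempe change turns into
    [p'], also missing at [b]. *)
Lemma kierstead_missing a b w x s p p' : near a b s -> (forall k, s k a = a \/ s k b = b) ->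
  H b w -> w != a -> H w x -> x != a -> x != b ->
  s p b = b -> s p' b = b -> p != p' -> s p x = x -> False.
Proof.
move=> ns cov Hbw nwa Hwx nxa nxb spb sp'b npp' spx; have sK := near_inv ns.
have nwb : w != b by rewrite eq_sym H_neq.
have nxw : x != w by rewrite eq_sym H_neq.
have [_ cs] := ns.
have [i sib] : exists i, s i b = w.
  by apply: near_edge cs Hbw _; rewrite /same_edge (negbTE nwa) (negbTE nwb) !andbF.
have [j sjw] : exists j, s j w = x.
  by apply: near_edge cs Hwx _; rewrite /same_edge (negbTE nwa) (negbTE nwb).
have sia : s i a = a by case: (cov i) => //; rewrite sib => e; rewrite e eqxx in nwb.
case: (cov j) => [sja|sjb]; last first.
  exact: kierstead_core ns nwa nwb nxa nxb spb spx sia sib sjb sjw.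
have sjx : s j x = w by rewrite -sjw sK.
have [aC bC] : a \notin comp s j p x /\ b \notin comp s j p x.
  by apply: apart ns sja spb nxa nxb _; right.
have wC : w \in comp s j p x by rewrite -sjx comp_stepl ?comp_refl.
set s' := swap s j p (comp s j p x).
have ns' : near a b s' by apply: near_swap_comp.
have s'j : s' j x = x by rewrite /s' swap_inl ?comp_refl.
have s'p : s' p w = x by rewrite /s' swap_inr.
have s'a k : s' k a = s k a by rewrite /s' swap_out.
have s'b k : s' k b = s k b by rewrite /s' swap_out.
have [aD bD] : a \notin comp s' j p' x /\ b \notin comp s' j p' x.
  by apply: apart ns' _ _ nxa nxb _; rewrite ?s'a ?s'b //; left.
have npj : p != j by apply: contraNneq nxw => e; rewrite -spx e sjx.
apply: (kierstead_core (near_swap_comp j p' x ns') nwa nwb nxa nxb (p := p') (i := i) (j := p)).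
- by rewrite swap_out ?s'b.
- by rewrite swap_inr ?comp_refl.
- by rewrite swap_out ?s'a.
- by rewrite swap_out ?s'b.
- by rewrite swap_out ?s'b.
- by rewrite swap_other.
Qed.

(** A colour missing at [x] and [a] is turned into [p] by a Kempe change; a colour [q] missing at
    [x] and [b] is paired with one of [p], [p'] that differs from it. *)
Lemma kierstead_full a b w x s p p' q : near a b s -> (forall k, s k a = a \/ s k b = b) ->
  H b w -> w != a -> H w x -> x != a -> x != b ->
  s p b = b -> s p' b = b -> p != p' -> s q x <> x.
Proof.
move=> ns cov Hbw nwa Hwx nxa nxb spb sp'b npp' sqx.
case: (cov q) => [sqa|sqb]; last first.
  case: (eqVneq q p) => [e|nqp].
    by apply: (kierstead_missing ns cov Hbw nwa Hwx nxa nxb spb sp'b); rewrite // -e.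
  exact: (kierstead_missing ns cov Hbw nwa Hwx nxa nxb sqb spb).
have [aC bC] : a \notin comp s q p x /\ b \notin comp s q p x.
  by apply: apart ns sqa spb nxa nxb _; left.
apply: (kierstead_missing (near_swap_comp q p x ns) _ Hbw nwa Hwx nxa nxb _ _ npp').
- by move=> k; rewrite !swap_out.
- by rewrite swap_out.
- by rewrite swap_out.
- by rewrite swap_inr ?comp_refl.
Qed.

(** The uncoloured edge moves to [vw], so that [w] misses [i]. Once a Kempe change makes [y] miss
    [i] too, [wy] takes the colour [i], which frees [j] at [w]; the chain of [w] for [p] and [j]
    must then reach [v]. In these two colours only the loss of [wy] has altered [s]. *)
Lemma kite_link a v w x y s p q i j : near a v s ->
  w != a -> w != v -> x != w -> y != w -> y != x -> y != v ->
  s p v = v -> s i a = a -> s i v = w -> s p w = x -> s q x = x -> s q y = y ->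
  s j w = y -> i != q -> v \in comp (toggle s j w y) p j w.
Proof.
move=> ns nwa nwv nxw nyw nyx nyv spv sia siv spw sqx sqy sjw niq.
have sK := near_inv ns; have spx : s p x = w by rewrite -spw sK.
have sjy : s j y = w by rewrite -sjw sK.
have siw : s i w = v by rewrite -siv sK.
have npi : p != i by apply: contraNneq nwv => e; rewrite -siv -e spv.
have npj : p != j by apply: contraNneq nyx => e; rewrite -spw -sjw e.
have nqp : q != p by apply: contraNneq nxw => e; rewrite -spx -e sqx.
have njq : j != q by apply: contraNneq nyw => e; rewrite -sjy e sqy.
have nji : j != i by apply: contraNneq nyv => e; rewrite -sjw e siw.
set s2 := shift s i v a w.
have n2 : near v w s2 by apply: near_shift (nearC ns) _ _ _.
have s2K := near_inv n2.
have s2i : s2 i w = w by rewrite /s2 shiftE // (negbTE nwv) (negbTE nwa) eqxx.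
have s2o k z : k != i -> s2 k z = s k z by apply: shift_other.
have nqi : q != i by rewrite eq_sym.
(* [x] is a fan leaf at [w], as the colour [p] of [wx] is missing at [v]. So the chain from [w] ends
   at [x], and [y], where [q] is missing too, is not on it. *)
have xD : x \in comp s2 i q w.
  by apply: (fan_link (p := p) (nearC n2)) => //; rewrite s2o.
have mx : missing2 s2 i q x by right; rewrite s2o.
have my : missing2 s2 i q y by right; rewrite s2o.
have wC : w \notin comp s2 i q y.
  apply/negP => /(comp_sym (s2K i) (s2K q)) yD.
  have := two_ends (s2K i) (s2K q) (or_introl s2i) mx my xD yD nxw nyw.
  by move=> e; rewrite e eqxx in nyx.
set s3 := swap s2 i q (comp s2 i q y).
have n3 : near v w s3 by apply: near_swap_comp.
have s3K := near_inv n3.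
have s3y : s3 i y = y by rewrite /s3 swap_inl ?comp_refl // s2o.
have s3w : s3 i w = w by rewrite /s3 swap_out.
have s3o k z : k != i -> k != q -> s3 k z = s k z.
  by move=> ki kq; rewrite /s3 swap_other // s2o.
(* Both [w] and [y] miss [i], so the edge [wy] alone is a whole chain for [i] and [j]. *)
have cl : closed2 s3 i j [set w; y].
  split=> z; rewrite !inE !(inv_eq (s3K _)) ?s3y ?s3w //.
  by rewrite !s3o // sjw sjy orbC.
set s4 := swap s3 i j [set w; y].
have n4 : near v w s4 by apply: near_swap.
have s4j : s4 j w = w by rewrite /s4 swap_inr ?s3w // !inE eqxx.
have s4p z : s4 p z = s p z by rewrite /s4 swap_other // s3o // eq_sym.
have := link (nearC n4) s4j (_ : s4 p v = v); rewrite s4p => /(_ spv).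
rewrite comp_swapc (@eq_comp _ (toggle s j w y)) // => z.
  by rewrite s4p toggle_other.
rewrite toggle_off //; case: ifP => zwy.
  rewrite /s4 swap_inr ?inE //.
  by case/orP: zwy => /eqP->.
by rewrite /s4 swap_out ?inE ?zwy // s3o.
Qed.

(** [kite_link] applies to the uncoloured edge [av] and, after a shift, to [au]. Trading [au] for
    [av] in colour [p] only prolongs the chain of [w] from its end [v] to [a], where it stops
    because [j] is missing: it cannot reach [u]. *)
Lemma kite_normalized a u v w x y s p q : near a v s -> uniq [:: a; u; v; w; x; y] ->
  s p v = v -> s p a = u -> (forall k, k != p -> s k a = a) ->
  H v w -> H u w -> H w y ->
  s p w = x -> s q x = x -> s q y = y -> False.
Proof.
move=> ns; rewrite /= !inE !negb_or -!andbA.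
case/and5P=> nau nav naw nax /and5P[nay nuv nuw nux /and5P[nuy nvw nvx nvy]].
case/and4P=> nwx nwy nxy _ spv spa sa Hvw Huw Hwy spw sqx sqy.
have sK := near_inv ns; have [_ cs] := ns.
have spx : s p x = w by rewrite -spw sK.
have nqp : q != p by apply: contraNneq nwx => e; rewrite -spx -e sqx.
have [i siv] : exists i, s i v = w.
  apply: near_edge cs Hvw _; rewrite /same_edge (eq_sym w a) (negbTE naw).
  by rewrite (eq_sym v a) (negbTE nav) /= andbF.
have [i' siu] : exists i, s i u = w.
  apply: near_edge cs Huw _; rewrite /same_edge (eq_sym w a) (negbTE naw).
  by rewrite (eq_sym u a) (negbTE nau) /= andbF.
have [j sjw] : exists j, s j w = y.
  by apply: near_edge cs Hwy _; rewrite /same_edge (eq_sym w) (negbTE naw) (eq_sym w) (negbTE nvw).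
have sjy : s j y = w by rewrite -sjw sK.
have nip : i != p by apply: contraNneq nvw => e; rewrite -siv e spv.
have spu : s p u = a by rewrite -spa sK.
have ni'p : i' != p by apply: contraNneq naw => e; rewrite -siu e spu.
have njp : j != p by apply: contraNneq nxy => e; rewrite -sjw e spw.
(* The chain of colours [p] and [q] from [v] ends at [a], hence avoids [x]. *)
have xC : x \notin comp s p q v.
  have [vC _] : v \notin comp s p q x /\ a \notin comp s p q x.
    apply: apart (nearC ns) spv _ _ _ _; rewrite ?sa //; try by rewrite eq_sym.
    by right.
  by apply: contra vC; apply: comp_sym.
have niq : i != q.
  apply: contraNneq xC => e; have <- : s p (s q v) = x by rewrite -e siv.
  by apply/comp_stepl/comp_stepr/comp_refl.
have aC : a \in comp s p q v by apply: link (nearC ns) spv _; rewrite sa.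
have ni'q : i' != q.
  apply: contraNneq xC => e; have <- : s p (s q (s p a)) = x by rewrite spa -e siu.
  by apply/comp_stepl/comp_stepr/comp_stepl.
have vG : v \in comp (toggle s j w y) p j w.
  by apply: (kite_link (x := x) (q := q) ns _ _ _ _ _ _ spv (sa i nip)); rewrite // eq_sym.
set s1 := shift s p a v u.
have n1 : near a u s1 by apply: near_shift; rewrite // eq_sym.
have s1o k z : k != p -> s1 k z = s k z by apply: shift_other.
have s1p z : s1 p z = if z == a then v else if z == v then a else if z == u then u else s p z.
  exact: shiftE.
have s1u : s1 p u = u by rewrite s1p (eq_sym u a) (negbTE nau) (negbTE nuv) eqxx.
have s1w : s1 p w = x.
  by rewrite s1p (eq_sym w a) (negbTE naw) (eq_sym w v) (negbTE nvw) (eq_sym w u) (negbTE nuw).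
have uG : u \in comp (toggle s1 j w y) p j w.
  by apply: (kite_link (x := x) (q := q) (i := i') n1) => //;
     rewrite 1?eq_sym // s1o // sa.
set g := toggle s j w y in vG; set g1 := toggle s1 j w y in uG.
have npj : p != j by rewrite eq_sym.
have gp z : g p z = s p z by rewrite /g toggle_other.
have gj z : g j z = if (z == w) || (z == y) then z else s j z by apply: toggle_off.
have g1p z : g1 p z = s1 p z by rewrite /g1 toggle_other.
have g1j z : g1 j z = g j z by rewrite /g1 /g /toggle eqxx s1o.
have gpK : involutive (g p) by move=> z; rewrite !gp sK.
have gjK : involutive (g j).
  move=> z; rewrite (gj z); case: ifP => zwy; rewrite gj ?zwy //.
  by rewrite !(inv_eq (sK j)) sjw sjy orbC zwy sK.
(* The ends of this chain are [w] and [v], hence [a], which misses [j], is off it, and so is [u],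
   joined to [a] by the colour [p]. *)
have aG : a \notin comp g p j w.
  have gja : g j a = a by rewrite gj sa // if_same.
  have gjw : g j w = w by rewrite gj eqxx.
  have gpv : g p v = v by rewrite gp.
  apply/negP => aD.
  have := two_ends gpK gjK (or_intror gjw) (or_introl gpv) (or_intror gja) vG aD nvw naw.
  by move=> e; rewrite e eqxx in nav.
have uG' : u \notin comp g p j w.
  by apply: contra aG => /comp_stepl; rewrite gp spu.
have /subsetP/(_ u uG) : comp g1 p j w \subset a |: comp g p j w.
  apply: comp_sub => [|z|z].
  - by rewrite !inE connect0 orbT.
  - rewrite !in_setU1 g1p s1p => /predU1P[->|zG]; first by rewrite eqxx vG orbT.
    case: (eqVneq z a) => [_|_]; first by rewrite vG orbT.
    case: (eqVneq z v) => [_|_]; first by rewrite eqxx.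
    case: (eqVneq z u) => [e|_]; first by rewrite e (negbTE uG') in zG.
    by rewrite -gp comp_stepl ?orbT.
  - rewrite !in_setU1 g1j => /predU1P[->|zG]; last by rewrite comp_stepr ?orbT.
    by rewrite gj sa // if_same eqxx.
by rewrite in_setU1 eq_sym (negbTE nau) (negbTE uG').
Qed.

(** One Kempe change makes [p] missing at [x] and [y], unless [q = p] already. The next gives the
    colour [p] to [wx] and leaves the old colour of [wx] missing at [x] and [y]. *)
Lemma kite a u v w x y s p q : near a v s -> uniq [:: a; u; v; w; x; y] ->
  s p v = v -> s p a = u -> (forall k, k != p -> s k a = a) ->
  H v w -> H u w -> H w x -> H w y ->
  s q x = x -> s q y = y -> False.
Proof.
move=> ns un spv spa sa Hvw Huw Hwx Hwy.
have := un; rewrite /= !inE !negb_or -!andbA.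
case/and5P=> nau nav naw nax /and5P[nay nuv nuw nux /and5P[nuy nvw nvx nvy]].
case/and4P=> nwx nwy nxy _ sqx sqy.
(* Both [x] and [y] lie outside the chain joining [v] to [a]: exchanging the colours
   on its complement treats them simultaneously. *)
have step s' k : near a v s' -> s' p v = v -> s' p a = u -> (forall k, k != p -> s' k a = a) ->
    k != p -> missing2 s' p k x -> missing2 s' p k y ->
  exists C, [/\ near a v (swap s' p k C), [/\ closed2 s' p k C, x \in C & y \in C],
    swap s' p k C p v = v, swap s' p k C p a = u & (forall k', k' != p -> swap s' p k C k' a = a)].
  move=> ns' s'v s'a s'k nkp mx my; have s'K := near_inv ns'.
  have nC z : z != v -> z != a -> missing2 s' p k z -> z \in ~: comp s' p k v.
    move=> nzv nza mz; rewrite in_setC; apply/negP => /(comp_sym (s'K p) (s'K k)).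
    by apply/negP; case: (apart (nearC ns') s'v (s'k k nkp) nzv nza mz).
  have aC : a \notin ~: comp s' p k v.
    by rewrite in_setC negbK; apply: link (nearC ns') _ _; rewrite ?s'k.
  have vC : v \notin ~: comp s' p k v by rewrite in_setC negbK comp_refl.
  have cC : closed2 s' p k (~: comp s' p k v) by apply/closedC/comp_closed; apply: s'K.
  exists (~: comp s' p k v); rewrite !swap_out //; split=> //.
  - exact: near_swap.
  - by split=> //; apply: nC; rewrite // eq_sym.
  - by move=> k' nk'; rewrite swap_out // s'k.
have main s' : near a v s' -> s' p v = v -> s' p a = u -> (forall k, k != p -> s' k a = a) ->
    s' p x = x -> s' p y = y -> False.
  move=> ns' s'v s'a s'k s'x s'y; have s'K := near_inv ns'; have [_ cs] := ns'.
  have [j sjw] : exists j, s' j w = x.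
    apply: near_edge cs Hwx _; rewrite /same_edge (eq_sym w) (negbTE naw).
    by rewrite (eq_sym w) (negbTE nvw).
  have sjx : s' j x = w by rewrite -sjw s'K.
  have njp : j != p by apply: contraNneq nwx => e; rewrite -sjx e s'x.
  have [C [nC [cC xC yC] Cv Ca Ck]] :=
    step s' j ns' s'v s'a s'k njp (or_introl s'x) (or_introl s'y).
  have wC : w \in C by rewrite -sjx; case: cC => _ ->.
  by apply: (kite_normalized (q := j) nC un Cv Ca Ck Hvw Huw Hwy);
     rewrite ?swap_inl ?swap_inr.
case: (eqVneq q p) => [e|nqp]; first by apply: (main s); rewrite // -e.
have [C [nC [cC xC yC] Cv Ca Ck]] :=
  step s q ns spv spa sa nqp (or_intror sqx) (or_intror sqy).
by apply: (main _ nC Cv Ca Ck); rewrite swap_inl.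
Qed.

End NotColourable.
End Matchings.

(** * From colourings of edges to involutions and back *)

Section ColouringsOfGraphs.

Variable T : finType.
Implicit Types (G H : sgraph T) (x y z : T).

Definition adj G : rel T := fun x y => [set x; y] \in edges G.

Lemma eq_set2 x y z t : ([set x; y] == [set z; t]) = same_edge z t x y.
Proof.
rewrite eqEsubset !subUset !sub1set !inE (eq_sym z x) (eq_sym z y) (eq_sym t x).
rewrite (eq_sym t y) /same_edge.
by case: (x == z); case: (x == t); case: (y == z); case: (y == t).
Qed.

Lemma adj_sym G : symmetric (adj G).
Proof. by move=> x y; rewrite /adj setUC. Qed.

Lemma adj_irr G : irreflexive (adj G).
Proof.
move=> x; apply/negP => e; have /forall_inP/(_ _ e)/andP[_] := edgesP G.
by rewrite setUid cards1.
Qed.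

Lemma adj_vertices G x y : adj G x y -> x \in vertices G /\ y \in vertices G.
Proof.
move=> e; have /forall_inP/(_ _ e)/andP[/subsetP sub _] := edgesP G.
by split; apply: sub; rewrite !inE eqxx ?orbT.
Qed.

Lemma edge_adj G e : e \in edges G -> exists x y, e = [set x; y].
Proof.
move=> eG; have /forall_inP/(_ _ eG)/andP[_ /cards2P[x [y [_ ->]]]] := edgesP G.
by exists x, y.
Qed.

Lemma edge_colorable_colours G k :
  edge_colorable G k -> exists s : 'I_k -> T -> T, colours s (adj G).
Proof.
case/existsP=> c /forallP cP.
pose col x y := if insub [set x; y] is Some e then Some (c e) else None.
have colC x y : col x y = col y x by rewrite /col setUC.
have colA x y i : col x y = Some i -> adj G x y.
  by rewrite /col; case: insubP => // e ? _ _.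
have colI x y z i : col x y = Some i -> col x z = Some i -> y = z.
  move=> cy cz; have ay := colA _ _ _ cy; have az := colA _ _ _ cz.
  move: cy cz; rewrite /col; case: insubP => // e _ eE [ce]; case: insubP => // f _ fE [cf].
  have nd : ~~ [disjoint val e & val f].
    by apply/pred0Pn; exists x; rewrite /= eE fE !inE eqxx.
  case: (eqVneq e f) => [ef|nef]; last first.
    by have /forallP/(_ f)/implyP := cP e; rewrite nef nd ce cf eqxx => /(_ isT).
  have := set22 x y; rewrite -eE ef fE !inE => /orP[/eqP e'|/eqP //].
  by move: ay; rewrite e' adj_irr.
(* The default [x] records that the colour [i] is missing at [x]. *)
pose s i x := if [pick y | col x y == Some i] is Some y then y else x.
have sE x y i : col x y = Some i -> s i x = y.
  move=> cy; rewrite /s; case: pickP => [z /eqP cz|/(_ y)]; first exact: colI cz cy.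
  by rewrite cy eqxx.
have sN x i : s i x != x -> col x (s i x) = Some i.
  by rewrite /s; case: pickP => [z /eqP cz //|_]; rewrite eqxx.
exists s; split.
- move=> i x; case: (eqVneq (s i x) x) => [e|/sN]; first by rewrite e.
  by rewrite colC => /sE.
- by move=> i j z e nz; have := sN _ _ nz; rewrite e sN -?e // => -[].
- by move=> i z /sN/colA.
- move=> x y a; split; first by apply: contraTneq a => ->; rewrite adj_irr.
  have : col x y != None by rewrite /col insubT.
  by case E: (col x y) => [i|//] _; exists i; apply: sE.
Qed.

(** An edge receives a colour whose involution exchanges its ends; [subrel] lets a colouring be
    restricted to a subgraph. *)
Lemma colours_edge_colorable (K : finType) (s : K -> T -> T) (R : rel T) G :
  colours s R -> subrel (adj G) R -> edge_colorable G #|K|.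
Proof.
move=> [sK sI sR Rs] sub.
have ex (e : edge_type G) : exists k, forall z, z \in val e -> val e = [set z; s k z].
  have [x [y eE]] := edge_adj (valP e).
  have : adj G x y by rewrite /adj -eE (valP e).
  case/sub/Rs => _ [k sk]; exists k => z; rewrite eE !inE => /orP[]/eqP->; first by rewrite sk.
  by rewrite -sk sK setUC.
have [f fP] := fin_all_exists ex.
apply/existsP; exists [ffun e => enum_rank (f e)].
apply/forallP => e; apply/forallP => e'; apply/implyP => /andP[ne /pred0Pn[z /andP[ze ze']]].
rewrite !ffunE (inj_eq enum_rank_inj); apply: contraNneq ne => ff.
by apply/eqP/val_inj; rewrite (fP e z ze) (fP e' z ze') ff.
Qed.

Lemma chromatic_index_le G k : edge_colorable G k -> chromatic_index G <= k.
Proof. by rewrite /chromatic_index; case: ex_minnP => m _ + ck; apply. Qed.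

Lemma chromatic_index_colorable G : edge_colorable G (chromatic_index G).
Proof. by rewrite /chromatic_index; case: ex_minnP. Qed.

Lemma card_colours (K : finType) (s : K -> T -> T) (R : rel T) z :
  colours s R -> #|[set k | s k z != z]| = #|[set y | R z y]|.
Proof.
move=> [sK sI sR Rs].
have <- : [set s k z | k in [set k | s k z != z]] = [set y | R z y].
  apply/setP => y; rewrite [RHS]inE; apply/imsetP/idP => [[k]|].
    by rewrite inE => /sR Rz ->.
  by case/Rs=> nyz [k sk]; exists k; rewrite // inE sk.
rewrite card_in_imset // => k l; rewrite !inE => nk _ e; exact: sI e nk.
Qed.

(** Removing [z] and [f z] together preserves parity, so such pairs cannot exhaust an odd set. *)
Lemma odd_card_fixed (f : T -> T) (A : {set T}) :
  involutive f -> {in A, forall z, f z \in A} -> odd #|A| -> exists2 z, z \in A & f z = z.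
Proof.
move=> fK; elim: {A}#|A| {-2}A (leqnn #|A|) => [|n IH] A.
  by rewrite leqn0 => /eqP->.
move=> leA fA oddA; have /card_gt0P[z zA] : 0 < #|A| by case: #|A| oddA.
case: (eqVneq (f z) z) => [fz|nfz]; first by exists z.
have fzA : f z \in A :\ z by rewrite !inE nfz fA.
have cA : #|A| = #|A :\ z :\ f z|.+2.
  by rewrite (cardsD1 z) zA (cardsD1 (f z) (A :\ z)) fzA.
case: (IH (A :\ z :\ f z)).
- by move: leA; rewrite cA ltnS; apply: ltnW.
- move=> t; rewrite !in_setD1 => /and3P[ntf ntz tA].
  by rewrite (inj_eq (inv_inj fK)) ntz (inv_eq fK) ntf fA.
- by move: oddA; rewrite cA /= negbK.
- by move=> t; rewrite !inE => /and3P[_ _ tA] ft; exists t.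
Qed.

End ColouringsOfGraphs.

(** * Colourings of a vertex-splitting induced by the original graph *)

Section Splitting.

Variables (T : finType) (G0 G : sgraph T).

Lemma is_splitting_atC v v1 v2 N1 N2 :
  is_splitting_at G0 G v v1 v2 N1 N2 -> is_splitting_at G0 G v v2 v1 N2 N1.
Proof.
case=> [[vG v1G v2G n12] [N1n N2n dN uN] eV eE]; split.
- by rewrite eq_sym.
- by rewrite disjoint_sym setUC.
- by rewrite eV setUCA.
- by rewrite eE [X in X |: _]setUC -!setUA [X in _ |: (_ :|: X)]setUC.
Qed.

Variables (v v1 v2 : T) (N1 N2 : {set T}).
Hypothesis spG : is_splitting_at G0 G v v1 v2 N1 N2.

Lemma splitting_facts :
  [/\ forall x, (x \in N1) || (x \in N2) = adj G0 v x,
      forall x, x \in N1 -> x \notin N2,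
      forall x, ~~ adj G0 v1 x /\ ~~ adj G0 v2 x
    & [/\ v1 != v, v2 != v & v1 != v2]].
Proof.
case: spG => [[vG v1G v2G n12] [N1n N2n dN uN] eV eE]; split; last split=> //.
- by move=> x; rewrite -in_setU uN inE.
- by move=> x /(disjointFr dN)->.
- by move=> x; split; apply/negP => /adj_vertices[]; [rewrite (negbTE v1G)|rewrite (negbTE v2G)].
- by apply: contraNneq v1G => ->.
- by apply: contraNneq v2G => ->.
Qed.

Definition split_adj : rel T := fun x y =>
  [|| [&& adj G0 x y, x != v & y != v],
      (x == v1) && (y \in N1), (y == v1) && (x \in N1),
      (x == v2) && (y \in N2) | (y == v2) && (x \in N2)].

Lemma splitting_adj x y : adj G x y = same_edge v1 v2 x y || split_adj x y.
Proof.
case: spG => _ _ _ eE.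
have star a (N : {set T}) :
    ([set x; y] \in [set [set a; u] | u in N]) = (x == a) && (y \in N) || (y == a) && (x \in N).
  apply/imsetP/orP => [[u uN /eqP]|[]/andP[/eqP-> uN]].
  - by rewrite eq_set2 => /orP[]/andP[/eqP-> /eqP->]; rewrite uN eqxx; [left|right].
  - by exists y.
  - by exists x; rewrite // setUC.
rewrite /adj eE !inE eq_set2 !star /split_adj /adj negb_or (eq_sym v x) (eq_sym v y).
by rewrite -!orbA.
Qed.

Lemma split_adj_near : del (adj G) v1 v2 =2 split_adj.
Proof.
have [N12 Nd iso [n1 n2 n12]] := splitting_facts => x y.
rewrite /del splitting_adj; case: (boolP (same_edge _ _ _ _)) => //=; last by rewrite andbT.
have Nv1 : (v1 \in N1) || (v1 \in N2) = false.
  by rewrite N12 adj_sym; case: (iso v) => /negbTE.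
have Nv2 : (v2 \in N1) || (v2 \in N2) = false.
  by rewrite N12 adj_sym; case: (iso v) => _ /negbTE.
move/norP: (negbT Nv1) => [/negbTE a1 /negbTE a2].
move/norP: (negbT Nv2) => [/negbTE b1 /negbTE b2].
move=> /orP[]/andP[/eqP-> /eqP->]; rewrite /split_adj a1 a2 b1 b2 !andbF /=.
  by case: (iso v2) => /negbTE->.
by case: (iso v1) => _ /negbTE->.
Qed.

(** An edge at [v] keeps its colour when moved to [v1] or [v2]; the vertex [v], absent from [G],
    becomes a fixed point. *)
Definition split_colouring (K : finType) (s : K -> T -> T) k z :=
  if z == v1 then if s k v \in N1 then s k v else v1
  else if z == v2 then if s k v \in N2 then s k v else v2
  else if z == v then v
  else if s k z == v then if z \in N1 then v1 else v2 else s k z.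

Lemma split_colouring_colours (K : finType) (s : K -> T -> T) :
  colours s (adj G0) -> colours (split_colouring s) (del (adj G) v1 v2).
Proof.
move=> [sK sI sR Rs]; have [N12 Nd iso [n1 n2 n12]] := splitting_facts.
apply: (@colours_ext _ _ _ split_adj) => [x y|]; first by rewrite split_adj_near.
have s1 k : s k v1 = v1.
  by apply/eqP/negPn/negP => /sR; apply/negP; case: (iso (s k v1)).
have s2 k : s k v2 = v2.
  by apply/eqP/negPn/negP => /sR; apply/negP; case: (iso (s k v2)).
have Nv x : (x \in N1) || (x \in N2) -> [/\ x != v, x != v1 & x != v2].
  rewrite N12 => a; split; apply: contraTneq a => ->; rewrite ?adj_irr // adj_sym;
    by case: (iso v).
have sv k z : z != v -> s k z = v -> s k v = z /\ (z \in N1) || (z \in N2).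
  move=> nz e; have <- : s k v = z by rewrite -e sK.
  split=> //; rewrite N12 sR // -e sK; by rewrite e.
pose f := split_colouring s.
have f1 k : f k v1 = if s k v \in N1 then s k v else v1 by rewrite /f /split_colouring eqxx.
have f2 k : f k v2 = if s k v \in N2 then s k v else v2.
  by rewrite /f /split_colouring eqxx eq_sym (negbTE n12).
have fv k : f k v = v.
  by rewrite /f /split_colouring eqxx eq_sym (negbTE n1) eq_sym (negbTE n2).
have fo k z : z != v1 -> z != v2 -> z != v ->
    f k z = if s k z == v then if z \in N1 then v1 else v2 else s k z.
  by rewrite /f /split_colouring => /negbTE-> /negbTE-> /negbTE->.
have fN1 k z : z \in N1 -> s k v = z -> f k z = v1 /\ f k v1 = z.
  move=> zN e; have [|nz nz1 nz2] := Nv z; rewrite ?zN //.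
  by rewrite f1 e zN fo // -e sK eqxx e zN.
have fN2 k z : z \in N2 -> s k v = z -> f k z = v2 /\ f k v2 = z.
  move=> zN e; have [|nz nz1 nz2] := Nv z; rewrite ?zN ?orbT //.
  have zN1 : z \in N1 = false by apply: contraTF zN => /Nd.
  by rewrite f2 e zN fo // -e sK eqxx e zN1.
(* Unless [k] is missing at [z], either [z] is an end of a moved edge of colour [k], or its edge of
   colour [k] avoids [v]. *)
have spec k z : [\/ f k z = z, z \in N1 /\ s k v = z, z \in N2 /\ s k v = z |
   (z = v1 /\ s k v \in N1) \/ (z = v2 /\ s k v \in N2) \/
   [/\ z != v1, z != v2, z != v, s k z != v & f k z = s k z]].
  case: (eqVneq z v1) => [->|nz1].
    by rewrite f1; case: ifP => sN; [apply: Or44; left | apply: Or41].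
  case: (eqVneq z v2) => [->|nz2].
    by rewrite f2; case: ifP => sN; [apply: Or44; right; left | apply: Or41].
  case: (eqVneq z v) => [->|nz]; first by apply: Or41.
  case: (eqVneq (s k z) v) => [e|ne].
    by case: (sv k z nz e) => e' /orP[] zN; [apply: Or42|apply: Or43].
  by apply: Or44; right; right; split=> //; rewrite fo // (negbTE ne).
rewrite -/f; split.
- move=> k z; case: (spec k z) => [e|[zN e]|[zN e]|[[-> zN]|[[-> zN]|[nz1 nz2 nz ne e]]]].
  + by rewrite !e.
  + by have [-> ->] := fN1 k z zN e.
  + by have [-> ->] := fN2 k z zN e.
  + by have [e1 e2] := fN1 k (s k v) zN erefl; rewrite e2.
  + by have [e1 e2] := fN2 k (s k v) zN erefl; rewrite e2.
  + rewrite e fo // ?sK ?(negbTE nz) //.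
    * by rewrite (inv_eq (sK k)) s1.
    * by rewrite (inv_eq (sK k)) s2.
- move=> k l z.
  case: (eqVneq z v1) => [->|nz1].
    rewrite !f1; case: ifP => zN; last by rewrite eqxx.
    case: ifP => zN' e nz; last by rewrite e eqxx in nz.
    by apply: (sI _ _ v) => //; case: (Nv (s k v)); rewrite ?zN.
  case: (eqVneq z v2) => [->|nz2].
    rewrite !f2; case: ifP => zN; last by rewrite eqxx.
    case: ifP => zN' e nz; last by rewrite e eqxx in nz.
    by apply: (sI _ _ v) => //; case: (Nv (s k v)); rewrite ?zN ?orbT.
  case: (eqVneq z v) => [->|nz]; first by rewrite fv eqxx.
  have skz1 j : s j z != v1 by rewrite (inv_eq (sK j)) s1.
  have skz2 j : s j z != v2 by rewrite (inv_eq (sK j)) s2.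
  rewrite !fo //; case: (eqVneq (s k z) v) => [ek|nk]; case: (eqVneq (s l z) v) => [el|nl].
  + by move=> _ _; apply: (sI _ _ z); rewrite ek ?el // eq_sym.
  + by case: ifP => _ e; have := skz1 l; have := skz2 l; rewrite -e eqxx.
  + by case: ifP => _ e; have := skz1 k; have := skz2 k; rewrite e eqxx.
  + exact: sI.
- move=> k z; case: (spec k z) => [->|[zN e] _|[zN e] _|[[-> zN] _|[[-> zN] _|[nz1 nz2 nz ne e]]]].
  + by rewrite eqxx.
  + by have [-> _] := fN1 k z zN e; rewrite /split_adj eqxx zN !orbT.
  + by have [-> _] := fN2 k z zN e; rewrite /split_adj eqxx zN !orbT.
  + by rewrite f1 zN /split_adj eqxx zN !orbT.
  + by rewrite f2 zN /split_adj eqxx zN !orbT.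
  + by rewrite e => /sR a; rewrite /split_adj a nz ne.
- have star x : (x \in N1) || (x \in N2) -> exists k, s k v = x.
    by rewrite N12 => /Rs[].
  move=> x y /or4P[/and3P[/Rs[nyx [k e]] nx ny]| | |/orP[]] => [|/andP[/eqP-> yN]|
    /andP[/eqP-> yN]|/andP[/eqP-> yN]|/andP[/eqP-> yN]].
  + split=> //; exists k; rewrite fo // ?e ?(negbTE ny) //.
    * by apply: contraNneq nyx => ex; rewrite -e ex s1.
    * by apply: contraNneq nyx => ex; rewrite -e ex s2.
  + have [|_ ny _] := Nv y; rewrite ?yN //; split=> //.
    by have [|k e] := star y; rewrite ?yN //; exists k; case: (fN1 k y yN e).
  + have [|_ ny _] := Nv x; rewrite ?yN // eq_sym; split=> //.
    by have [|k e] := star x; rewrite ?yN //; exists k; case: (fN1 k x yN e).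
  + have [|_ _ ny] := Nv y; rewrite ?yN ?orbT //; split=> //.
    by have [|k e] := star y; rewrite ?yN ?orbT //; exists k; case: (fN2 k y yN e).
  + have [|_ _ ny] := Nv x; rewrite ?yN ?orbT // eq_sym; split=> //.
    by have [|k e] := star x; rewrite ?yN ?orbT //; exists k; case: (fN2 k x yN e).
Qed.

(** [q] is the colour of [xy], freed by its removal; the formulas at [v1] and [v2] tell which
    colours are missing there. *)
Lemma near_split (K : finType) (s : K -> T -> T) x y :
  colours s (adj G0) -> adj G0 x y -> x != v -> y != v ->
  exists (s' : K -> T -> T) q,
    [/\ near (del (adj G) x y) v1 v2 s', s' q x = x, s' q y = y,
        forall k, s' k v1 = if s k v \in N1 then s k v else v1
      & forall k, s' k v2 = if s k v \in N2 then s k v else v2].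
Proof.
move=> cs axy nxv nyv; have [N12 Nd iso [n1 n2 n12]] := splitting_facts.
have cf := split_colouring_colours cs; set f := split_colouring s in cf.
have nz12 z t : adj G0 z t -> (z != v1) && (z != v2).
  move=> a; apply/andP; split; apply: contraTneq a => ->; by case: (iso t).
have /andP[nx1 nx2] := nz12 _ _ axy; have := axy; rewrite adj_sym => /nz12/andP[ny1 ny2].
have [fK _ _ fR] := cf.
have [nyx [q fq]] : y != x /\ exists k, f k x = y.
  by apply: fR; rewrite split_adj_near /split_adj axy nxv nyv.
have tE k z : z != x -> z != y -> toggle f q x y k z = f k z.
  move=> nzx nzy; case: (eqVneq k q) => [->|nkq]; last by rewrite toggle_other.
  by rewrite toggle_off // (negbTE nzx) (negbTE nzy).
exists (toggle f q x y), q; split.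
- split.
    rewrite /del splitting_adj /same_edge !eqxx /= (eq_sym v1) (negbTE nx1).
    by rewrite (eq_sym v1) (negbTE ny1).
  apply: colours_ext (del_colours nyx fq cf) => a b.
  by rewrite /del -!andbA [X in _ && X]andbC.
- by rewrite toggle_off // eqxx.
- by rewrite toggle_off // eqxx orbT.
- by move=> k; rewrite tE 1?eq_sym // /f /split_colouring eqxx.
- by move=> k; rewrite tE 1?eq_sym // /f /split_colouring eqxx eq_sym (negbTE n12).
Qed.

Variables (K : finType) (s : K -> T -> T).
Hypothesis cs : colours s (adj G0).

(** The colour of [vx] went to the side of [v1], so it is missing at [v2], and [v1v2] can take it
    over from [v1x]. *)
Lemma del_incident_colourable x :
  x \in N1 -> exists s' : K -> T -> T, colours s' (del (adj G) v1 x).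
Proof.
move=> xN; have [N12 Nd iso [n1 n2 n12]] := splitting_facts.
have [_ _ _ Rs] := cs; have [_ [k sk]] : x != v /\ exists k, s k v = x.
  by apply: Rs; rewrite -N12 xN.
have nx1 : x != v1.
  apply: contraTneq (xN) => ->; apply/negP => h; have := N12 v1.
  by rewrite h adj_sym /=; case: (iso v) => /negbTE->.
have a12 : adj G v1 v2 by rewrite splitting_adj /same_edge !eqxx.
exists (shift (split_colouring s) k v1 v2 x).
apply: (shift_colours n12 a12 _ (split_colouring_colours cs)) => //.
- by rewrite adj_sym.
- by rewrite /split_colouring eqxx eq_sym (negbTE n12) sk (negbTE (Nd _ xN)).
- by rewrite /split_colouring eqxx sk xN.
Qed.

Lemma split_cover s' : (forall k, s' k v1 = if s k v \in N1 then s k v else v1) ->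
  (forall k, s' k v2 = if s k v \in N2 then s k v else v2) ->
  forall k : K, s' k v1 = v1 \/ s' k v2 = v2.
Proof.
move=> s'1 s'2 k; have [_ Nd _ _] := splitting_facts.
rewrite s'1 s'2; case: ifP => [/Nd/negbTE->|_]; [by right|by left].
Qed.

(** If no colouring existed, the leaf [x] of a fan at [v1] would miss no colour, but it misses the
    old colour of [xy]. *)
Lemma near_hub_colourable x y :
  adj G0 x y -> y != v -> x \in N1 ->
  ~ forall s' : K -> T -> T, ~ colours s' (del (adj G) x y).
Proof.
move=> axy nyv xN noH; have [N12 Nd iso [n1 n2 n12]] := splitting_facts.
have [_ [_ /set0Pn[t tN] _ _] _ _] := spG.
have avx : adj G0 v x by rewrite -N12 xN.
have nxv : x != v by apply: contraTneq avx => ->; rewrite adj_irr.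
have nx2 : x != v2.
  by apply: contraTneq avx => ->; rewrite adj_sym; case: (iso v).
(* An element [t] of [N2] supplies the colour missing at [v1] that [fan_full] requires. *)
have [_ _ _ Rs] := cs; have [_ [p sp]] : t != v /\ exists k, s k v = t.
  by apply: Rs; rewrite -N12 tN orbT.
have [s' [q [ns' s'x s'y s'1 s'2]]] := near_split cs axy nxv nyv.
have ny1 : y != v1.
  by apply: contraTneq axy => ->; rewrite adj_sym; case: (iso x).
have nx1 : x != v1.
  by apply: contraTneq axy => ->; case: (iso y).
apply: (@fan_full _ _ _ _ _ noH v1 v2 x s' p q) => //.
- exact/del_sym/adj_sym.
- by move=> a; rewrite /del adj_irr.
- exact: split_cover s'1 s'2.
- by rewrite s'1 sp; case: ifP => // /Nd; rewrite tN.
- rewrite /del splitting_adj /split_adj eqxx xN /= !orbT /=.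
  by rewrite /same_edge (eq_sym v1 y) (negbTE ny1) (eq_sym v1 x) (negbTE nx1).
Qed.

(** Each element of [N1] supplies a colour missing at [v2]: two of them allow a Kierstead path, a
    single one leads to a kite. *)
Lemma far_colourable x y w : adj G0 x y -> x != v -> y != v ->
  ~~ adj G0 v x -> ~~ adj G0 v y -> w \in N2 -> adj G0 w x -> adj G0 w y ->
  (forall u, N1 = [set u] -> adj G0 u w) ->
  ~ forall s' : K -> T -> T, ~ colours s' (del (adj G) x y).
Proof.
move=> axy nxv nyv navx navy wN awx awy Nu noH.
have [N12 Nd iso [n1 n2 n12]] := splitting_facts.
have [_ [/set0Pn[u uN] _ _ _] _ _] := spG.
have nz12 z t : adj G0 z t -> (z != v1) && (z != v2).
  move=> a; apply/andP; split; apply: contraTneq a => ->; by case: (iso t).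
have /andP[nx1 nx2] := nz12 _ _ axy; have := axy; rewrite adj_sym => /nz12/andP[ny1 ny2].
have /andP[nw1 nw2] := nz12 _ _ awx.
have neq a b : adj G0 a b -> a != b by apply: contraTneq => ->; rewrite adj_irr.
have nwx := neq _ _ awx; have nwy := neq _ _ awy; have nxy := neq _ _ axy.
have nwv : w != v by rewrite eq_sym neq // -N12 wN orbT.
have [s' [q [ns' s'x s'y s'1 s'2]]] := near_split cs axy nxv nyv.
set H := del (adj G) x y in noH ns'.
have Hsym : symmetric H by apply/del_sym/adj_sym.
have Hirr : irreflexive H by move=> a; rewrite /H /del adj_irr.
have H0 a b : adj G0 a b -> a != v -> b != v -> a != x -> a != y -> H a b.
  move=> aab nav nbv nax nay.
  by rewrite /H /del splitting_adj /split_adj aab nav nbv orbT /same_edge (negbTE nax) (negbTE nay).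
have H2 : H v2 w.
  rewrite /H /del splitting_adj /split_adj eqxx wN /= !orbT /same_edge.
  by rewrite (eq_sym v2 x) (negbTE nx2) (eq_sym v2 y) (negbTE ny2).
have Hwx : H w x by apply: H0.
have Hwy : H w y by apply: H0.
have [_ sI _ Rs] := cs.
have N1c a : a \in N1 -> exists p, s p v = a /\ s' p v2 = v2.
  move=> aN; have [_ [p sp]] : a != v /\ exists k, s k v = a.
    by apply: Rs; rewrite -N12 aN.
  by exists p; rewrite s'2 sp (negbTE (Nd _ aN)).
have [p [sp s'p2]] := N1c u uN.
case: (boolP (N1 == [set u])) => [/eqP N1E|].
  have auw := Nu u N1E; have avu : adj G0 v u by rewrite -N12 uN.
  have nuv : u != v by rewrite eq_sym neq.
  have /andP[nu1 nu2] := nz12 _ _ auw.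
  have nux : u != x by apply: contraNneq navx => <-.
  have nuy : u != y by apply: contraNneq navy => <-.
  apply: (@kite _ _ _ Hsym Hirr noH v1 u v2 w x y s' p q) => //.
  - rewrite /= !inE !negb_or n12 nwx nwy nxy nux nuy nu2 (neq _ _ auw).
    by rewrite !(eq_sym v1) !(eq_sym v2) nu1 nw1 nx1 ny1 nw2 nx2 ny2.
  - by rewrite s'1 sp uN.
  (* As [N1] is [{u}], the colour of [vu] is the only one present at [v1]. *)
  - move=> k nkp; rewrite s'1 N1E inE; case: eqP => // sk.
    by rewrite (sI k p v) ?eqxx // ?sk // in nkp.
  - exact: H0.
rewrite eqEsubset sub1set uN andbT => /subsetPn[u' u'N]; rewrite inE => nu'u.
have [p' [sp' s'p'2]] := N1c u' u'N.
apply: (@kierstead_full _ _ _ Hsym Hirr noH v1 v2 w x s' p p' q) => //.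
- exact: split_cover s'1 s'2.
- by apply: contraNneq nu'u => e; rewrite -sp -sp' e.
Qed.

End Splitting.

(** * Splitting a regular graph of large degree *)

Section RegularSplitting.

Variables (T : finType) (G0 G : sgraph T) (D : nat).
Hypothesis regG0 : regular D G0.

(* The non-neighbourhoods of [v] and [x] overlap in [x], hence four non-neighbourhoods
   of size at most a quarter of the order do not cover the graph. *)
Lemma common_neighbor u v x y :
  3 * #|vertices G0| <= 4 * D -> u \in vertices G0 -> v \in vertices G0 ->
  x \in vertices G0 -> y \in vertices G0 -> ~~ adj G0 v x ->
  exists w, [/\ adj G0 v w, adj G0 u w, adj G0 w x & adj G0 w y].
Proof.
move=> leD uV vV xV yV navx; set V := vertices G0 in leD *.
pose B z := V :\: neighborhood G0 z.
have inB z w : (w \in B z) = ~~ adj G0 z w && (w \in V) by rewrite !inE.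
have cB z : z \in V -> #|B z| + D = #|V|.
  move=> zV; rewrite -(regG0 zV) /degree -[RHS](cardsID (neighborhood G0 z)) addnC.
  congr (_ + _); apply: eq_card => w; rewrite !inE andbC.
  by case: (boolP (_ \in edges _)) => //= /adj_vertices[].
have cvx : 0 < #|B v :&: B x|.
  by apply/card_gt0P; exists x; rewrite in_setI !inB navx adj_irr xV.
have : #|B v :|: B x :|: (B u :|: B y)| < #|V|.
  have := cB v vV; have := cB x xV; have := cB u uV; have := cB y yV.
  have := (leq_card_setU (B v :|: B x) (B u :|: B y)).1.
  have := (leq_card_setU (B u) (B y)).1; have := cardsUI (B v) (B x).
  by move: leD cvx; clear; lia.
move=> lt; have /subsetPn[w wV] : ~~ (V \subset B v :|: B x :|: (B u :|: B y)).
  by apply: contraTN lt => /subset_leq_card; rewrite -leqNgt.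
rewrite !in_setU !inB wV !andbT !negb_or !negbK => /andP[/andP[vw xw] /andP[uw yw]].
by exists w; rewrite [adj G0 w x]adj_sym [adj G0 w y]adj_sym.
Qed.

Lemma regular_colours_full (s : 'I_D -> T -> T) z k :
  colours s (adj G0) -> z \in vertices G0 -> s k z != z.
Proof.
move=> cs zV; have := card_colours z cs; rewrite -[RHS]/(degree G0 z) (regG0 zV).
move=> c; have /eqP e : [set k | s k z != z] == setT.
  by rewrite eqEcard subsetT cardsT card_ord c leqnn.
by have := in_setT k; rewrite -e inE.
Qed.

Variables (v v1 v2 : T) (N1 N2 : {set T}) (s : 'I_D -> T -> T).
Hypotheses (spG : is_splitting_at G0 G v v1 v2 N1 N2) (cs : colours s (adj G0)).

(** The cases are [v1v2], edges inherited from [G0] that meet the neighbourhood of [v] or avoid it,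
    and the other edges at [v1] or [v2]. The double negation provides the hypothesis of
    uncolourability for the Kempe chain arguments. *)
Lemma del_edge_colourable x y :
  3 * #|vertices G0| <= 4 * D -> adj G x y ->
  ~ forall s' : 'I_D -> T -> T, ~ colours s' (del (adj G) x y).
Proof.
move=> leD axy noH; have spC := is_splitting_atC spG.
have [N12 Nd iso [n1 n2 n12]] := splitting_facts spG.
have [[vV _ _ _] [N1n N2n _ _] _ _] := spG.
have noHC (s' : 'I_D -> T -> T) : ~ colours s' (del (adj G) y x) by move/coloursC; apply: noH.
move: axy; rewrite (splitting_adj spG) => /orP[/orP[]/andP[/eqP e1 /eqP e2]|].
- by rewrite e1 e2 in noH; apply: (noH _ (split_colouring_colours spG cs)).
- by rewrite e1 e2 in noHC; apply: (noHC _ (split_colouring_colours spG cs)).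
case/or4P=> [/and3P[axy nxv nyv]|/andP[/eqP e xN]|/andP[/eqP e xN]|/orP[]/andP[/eqP e xN]].
- have ayx : adj G0 y x by rewrite adj_sym.
  have navx : ~~ adj G0 v x.
    rewrite -N12; apply/norP; split; apply/negP => xN.
      exact: (near_hub_colourable spG cs axy nyv xN).
    exact: (near_hub_colourable spC cs axy nyv xN).
  have navy : ~~ adj G0 v y.
    rewrite -N12; apply/norP; split; apply/negP => yN.
      exact: (near_hub_colourable spG cs ayx nxv yN).
    exact: (near_hub_colourable spC cs ayx nxv yN).
  have [xV yV] := adj_vertices axy.
  have NV u : (u \in N1) || (u \in N2) -> u \in vertices G0.
    by rewrite N12 => /adj_vertices[].
  have nb u : u \in vertices G0 -> exists w, [/\ adj G0 v w, adj G0 u w, adj G0 w x & adj G0 w y].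
    by move=> uV; apply: common_neighbor.
  have irr u w : adj G0 u w -> w != u by apply: contraTneq => ->; rewrite adj_irr.
  case: (boolP (#|N1| == 1)) => [/cards1P[u N1E]|N1c].
    have [|w [avw auw awx awy]] := nb u; first by apply: NV; rewrite N1E set11.
    (* Being adjacent to [u], [w] differs from the only element of [N1]. *)
    have wN : w \in N2 by move: avw; rewrite -N12 N1E inE (negbTE (irr _ _ auw)).
    apply: (far_colourable spG cs axy nxv nyv navx navy wN awx awy _ noH) => u'.
    by rewrite N1E => /set1_inj<-.
  case: (boolP (#|N2| == 1)) => [/cards1P[u N2E]|N2c].
    have [|w [avw auw awx awy]] := nb u; first by apply: NV; rewrite N2E set11 orbT.
    have wN : w \in N1 by move: avw; rewrite -N12 N2E inE (negbTE (irr _ _ auw)) orbF.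
    apply: (far_colourable spC cs axy nxv nyv navx navy wN awx awy _ noH) => u'.
    by rewrite N2E => /set1_inj<-.
  (* Both sides now have at least two elements, so [v] stands in for [u] and [w] may lie on either
     side. *)
  have [w [avw _ awx awy]] := nb v vV.
  move: avw; rewrite -N12 => /orP[] wN.
    apply: (far_colourable spC cs axy nxv nyv navx navy wN awx awy _ noH) => u' e.
    by rewrite e cards1 in N2c.
  apply: (far_colourable spG cs axy nxv nyv navx navy wN awx awy _ noH) => u' e.
  by rewrite e cards1 in N1c.
- by have [s' cs'] := del_incident_colourable spG cs xN; apply: (noH s'); rewrite e.
- by have [s' cs'] := del_incident_colourable spG cs xN; apply: (noHC s'); rewrite e.
- by have [s' cs'] := del_incident_colourable spC cs xN; apply: (noH s'); rewrite e.
- by have [s' cs'] := del_incident_colourable spC cs xN; apply: (noHC s'); rewrite e.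
Qed.

Lemma degree_hub : degree G v1 = #|N1|.+1.
Proof.
have [N12 Nd iso [n1 n2 n12]] := splitting_facts spG.
have v2N : v2 \notin N1.
  apply/negP => h; have := N12 v2; rewrite h adj_sym /=.
  by case: (iso v) => _ /negbTE->.
have -> : degree G v1 = #|v2 |: N1|; last by rewrite cardsU1 v2N.
apply: eq_card => z; rewrite in_setU1 inE -/(adj G v1 z) (splitting_adj spG).
have v1N : v1 \notin N1.
  apply/negP => h; have := N12 v1; rewrite h adj_sym /=.
  by case: (iso v) => /negbTE->.
have v1N2 : v1 \notin N2.
  apply/negP => h; have := N12 v1; rewrite h orbT adj_sym /=.
  by case: (iso v) => /negbTE->.
rewrite /same_edge /split_adj eqxx (negbTE n12) (negbTE v1N) (negbTE v1N2) !andbF !orbF /=.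
by case: (iso z) => /negbTE->.
Qed.

(** All [D] colours are present at [z] in the induced colouring, whose only uncoloured edge [v1v2]
    does not meet [z]. *)
Lemma degree_other z : z \in vertices G0 -> z != v -> degree G z = D.
Proof.
move=> zV nzv; have [N12 Nd iso [n1 n2 n12]] := splitting_facts spG.
have [[_ v1V v2V _] _ _ _] := spG.
have nz1 : z != v1 by apply: contraNneq v1V => <-.
have nz2 : z != v2 by apply: contraNneq v2V => <-.
have := card_colours z (split_colouring_colours spG cs).
have -> : [set k | split_colouring v v1 v2 N1 N2 s k z != z] = setT.
  apply/setP => k; rewrite !inE /split_colouring (negbTE nz1) (negbTE nz2) (negbTE nzv).
  case: ifP => _; last exact: regular_colours_full.
  by case: ifP; rewrite eq_sym.
rewrite cardsT card_ord => ->; apply: eq_card => y; rewrite !inE /del /same_edge.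
by rewrite (negbTE nz1) (negbTE nz2) andbT.
Qed.

Lemma card_hub : #|N1| + #|N2| = D.
Proof.
have [[vV _ _ _] [_ _ dN uN] _ _] := spG.
by rewrite -(regG0 vV) /degree -uN cardsU disjoint_setI0 // cards0 subn0.
Qed.

End RegularSplitting.

(** * Parity, missing colours and criticality *)

Theorem theorem1p1 (n D : nat) (n_gt0 : 0 < n) (D_gt0 : 0 < D)
  (leD : 3 * (n - 1) <= 4 * D)
  (T : finType) (G0 G : sgraph T)
  (cardG0 : #|vertices G0| = n - 1) (regG0 : regular D G0) (clG0 : class1 G0)
  (splitG : vertex_splitting G0 G) :
  critical D G.
Proof.
have [v [v1 [v2 [N1 [N2 spG]]]]] := splitG; have spC := is_splitting_atC spG.
have [[vV v1V v2V n12] [/set0Pn[u1 u1N] /set0Pn[u2 u2N] dN uN] GV _] := spG.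
have max0 : max_degree G0 = D.
  apply/eqP; rewrite eqn_leq; apply/andP; split.
    by apply/bigmax_leqP => z /regG0->.
  by rewrite -(regG0 v vV) /max_degree; apply: leq_bigmax_cond.
have [s cs] : exists s : 'I_D -> T -> T, colours s (adj G0).
  by apply: edge_colorable_colours; rewrite -max0 -clG0 chromatic_index_colorable.
have cN := card_hub regG0 spG.
have N1_gt0 : 0 < #|N1| by apply/card_gt0P; exists u1.
have N2_gt0 : 0 < #|N2| by apply/card_gt0P; exists u2.
have deg1 := degree_hub spG; have deg2 := degree_hub spC.
have degz z := degree_other regG0 spG cs (z := z).
have [N12 Nd iso [n1 n2 _]] := splitting_facts spG.
have u1V : u1 \in vertices G0 by have := N12 u1; rewrite u1N => /esym/adj_vertices[].
have nu1v : u1 != v.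
  by have := N12 u1; rewrite u1N => /esym; apply: contraTneq => ->; rewrite adj_irr.
have Gz z : z \in vertices G -> [\/ z = v1, z = v2 | z \in vertices G0 /\ z != v].
  rewrite GV !inE => /predU1P[->|/predU1P[->|/andP[]]]; [exact: Or31|exact: Or32|].
  by move=> nzv zV; apply: Or33.
have u1G : u1 \in vertices G by rewrite GV !inE u1V nu1v !orbT.
have maxG : max_degree G = D.
  apply/eqP; rewrite eqn_leq; apply/andP; split.
    apply/bigmax_leqP => z /Gz[->|->|[zV nzv]]; rewrite ?deg1 ?deg2 ?degz //.
      (* [N2] is nonempty, which makes up for the extra neighbour [v2] of [v1]. *)
      by rewrite -cN -addn1 leq_add2l.
    by rewrite -cN -add1n leq_add2r.
  by rewrite -(degz u1 u1V nu1v) /max_degree; apply: leq_bigmax_cond.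
have a12 : adj G v1 v2 by rewrite (splitting_adj spG) /same_edge !eqxx.
have cs1 := split_colouring_colours spG cs.
have chi : chromatic_index G = D.+1.
  have le : chromatic_index G <= D.+1.
    apply: chromatic_index_le; have -> : D.+1 = #|{: option 'I_D}| by rewrite card_option card_ord.
    (* The new colour [None] is missing everywhere, hence available for [v1v2]. *)
    pose s' (k : option 'I_D) z := if k is Some k' then split_colouring v v1 v2 N1 N2 s k' z else z.
    have cs' : colours s' (del (adj G) v1 v2).
      case: cs1 => [sK sI sR Rs]; split.
      - by move=> [k|] z //=; apply: sK.
      - move=> [k|] [l|] z //= e nz; last by rewrite eqxx in nz.
          by congr Some; apply: (sI _ _ z).
        by rewrite e eqxx in nz.
      - by move=> [k|] z /=; [apply: sR | rewrite eqxx].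
      - by move=> x y /Rs[nyx [k e]]; split=> //; exists (Some k).
    apply: (@colours_edge_colorable _ _ (toggle s' None v1 v2) (adj G)) => //.
    by apply: add_colours => //; rewrite adj_sym.
  have [m mE] : exists m, chromatic_index G = m by exists (chromatic_index G).
  have [t ct] : exists t : 'I_m -> T -> T, colours t (adj G).
    by apply: edge_colorable_colours; rewrite -mE chromatic_index_colorable.
  have miss z : #|[set k | t k z == z]| + degree G z = m.
    rewrite -[RHS](card_ord m) -cardsT -(cardsID [set k | t k z == z] setT).
    rewrite setTI; congr (_ + _); rewrite -[LHS](card_colours z ct).
    by apply: eq_card => k; rewrite !inE andbT.
  apply/eqP; rewrite eqn_leq le /= ltnNge mE; apply/negP => leD'.
  (* A colour of [G0], which exists since [D > 0], is a perfect matching, so [G0] has even order;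
     [G] has one vertex more. *)
  have evenV0 : ~~ odd #|vertices G0|.
    apply/negP => oddV0; have [sK _ sR _] := cs.
    have [|z zV] := odd_card_fixed (sK (Ordinal D_gt0)) _ oddV0.
      move=> z zV; have := regular_colours_full regG0 (Ordinal D_gt0) cs zV.
      by move=> /sR/adj_vertices[].
    by apply/eqP; apply: regular_colours_full zV.
  have oddV : odd #|vertices G|.
    rewrite GV !cardsU1 !inE (negbTE n12) (negbTE v1V) (negbTE v2V) !andbF /=.
    by move: evenV0; rewrite (cardsD1 v) vV /= negbK => ->.
  (* By parity every colour misses some vertex, and with [m <= D] a vertex of degree [D] misses
     none. *)
  have : #|[set: 'I_m]| <= #|[set k | t k v1 == v1] :|: [set k | t k v2 == v2]|.
    apply: subset_leq_card; apply/subsetP => k _; rewrite !inE; have [tK _ tR _] := ct.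
    have [|z zV tz] := odd_card_fixed (tK k) _ oddV.
      move=> z zV; case: (eqVneq (t k z) z) => [-> //|/tR/adj_vertices[] //].
    case: (Gz z zV) => [<-|<-|[z0 nzv]]; rewrite ?tz ?eqxx ?orbT //.
    have kz : 0 < #|[set k | t k z == z]| by apply/card_gt0P; exists k; rewrite inE tz.
    by have := miss z; rewrite degz //; move: kz leD'; clear; lia.
  (* At most [2m - (D + 2)] colours are missing at [v1] or [v2], fewer than [m] when [m <= D]. *)
  have := (leq_card_setU [set k | t k v1 == v1] [set k | t k v2 == v2]).1.
  have := miss v1; have := miss v2; rewrite deg1 deg2 cardsT card_ord.
  by move: leD' cN; clear; lia.
split=> //; first by rewrite maxG.
move=> H /andP[/andP[sV sE] nHG]; rewrite maxG ltnS; apply: chromatic_index_le.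
(* A proper subgraph lacks an edge: all degrees in [G] are positive, so the loss of a vertex entails
   the loss of an edge. *)
have [x [y [axy nxy]]] : exists x y, adj G x y /\ ~~ adj H x y.
  case: (boolP (edges G \subset edges H)) => [sEG|/subsetPn[e eG eH]]; last first.
    by have [x [y eE]] := edge_adj eG; exists x, y; rewrite /adj -eE.
  move: nHG; rewrite /subgraph sEG andbT => /subsetPn[z zG /negP[]].
  have : 0 < degree G z by case: (Gz z zG) => [->|->|[zV nzv]]; rewrite ?deg1 ?deg2 ?degz.
  by case/card_gt0P=> y; rewrite inE => /(subsetP sEG)/adj_vertices[].
apply: contraT => nc; exfalso.
apply: (del_edge_colourable regG0 spG cs _ axy); first by rewrite cardG0.
move=> s' cs'; move/negP: nc; apply; rewrite -(card_ord D).
apply: (colours_edge_colorable cs') => a b ab.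
have abG : adj G a b by apply: (subsetP sE).
rewrite /del abG /=; apply: contra nxy; rewrite -eq_set2 => /eqP e.
by rewrite /adj -e.
Qed.
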